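(* There is an absolute constant $C>0$ such that the following holds. Let $n\ge 1$ and let $f:\{0,1\}^n\to\{0,1\}$ be any boolean function. Define the $4$-argument XOR function $F:(\{0,1\}^n)^4\to\{0,1\}$ by $F(x_1,x_2,x_3,x_4)=f(x_1\oplus x_2\oplus x_3\oplus x_4)$, where $\oplus$ is bitwise XOR. Then \[\mathrm{PDT}(f)\le C\cdot \mathrm{CC}_4(F)^5 .\]
   Context: A parity decision tree (PDT) for $f$ is a rooted tree whose internal nodes are labelled by subsets $S\subseteq[n]$ and whose leaves are labelled by values in $\{0,1\}$; on input $x$ one starts at the root, at each internal node queries the parity $\sum_{i\in S}x_i \bmod 2$ and follows the branch given by the answer, and outputs the label of the leaf reached. $\mathrm{PDT}(f)$ is the minimum, over PDTs computing $f$ correctly on all inputs, of the maximum number of queries made on any input (the depth). $\mathrm{CC}_4(F)$ is the deterministic number-in-hand multiparty communication complexity of $F$ in the blackboard model: there are $4$ players, player $P_i$ receives $x_i\in\{0,1\}^n$, every message is written on a blackboard visible to all players, and $\mathrm{CC}_4(F)$ is the least number of bits that must be communicated in the worst case by a deterministic protocol that computes $F$ correctly on all inputs. *)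

(* Defs.v *)
From mathcomp Require Import all_boot.
From Stdlib Require Import ClassicalEpsilon.
Set Implicit Arguments. Unset Strict Implicit. Unset Printing Implicit Defensive.

Definition bits (n : nat) := {ffun 'I_n -> bool}.

(* least natural number satisfying P (0 if none exists; classical) *)
Definition natmin (P : nat -> Prop) : nat :=
  match excluded_middle_informative
          (exists d, P d /\ forall e, P e -> d <= e) with
  | left h => proj1_sig (constructive_indefinite_description _ h)
  | right _ => 0
  end.

Inductive pdt (n : nat) : Type :=
  | PLeaf : bool -> pdt n
  | PQuery : {set 'I_n} -> pdt n -> pdt n -> pdt n.

Definition parity n (S : {set 'I_n}) (x : bits n) : bool :=
  \big[addb/false]_(i in S) x i.

Fixpoint pdt_eval n (t : pdt n) (x : bits n) : bool :=
  match t with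
  | PLeaf b => b
  | PQuery A t0 t1 => if parity A x then pdt_eval t1 x else pdt_eval t0 x
  end.

Fixpoint pdt_depth n (t : pdt n) : nat :=
  match t with
  | PLeaf _ => 0
  | PQuery _ t0 t1 => (maxn (pdt_depth t0) (pdt_depth t1)).+1
  end.

Definition PDT n (f : bits n -> bool) : nat :=
  natmin (fun d => exists t : pdt n,
             (forall x, pdt_eval t x = f x) /\ pdt_depth t = d).

(* ---------- deterministic number-in-hand blackboard protocols, k players ----
   Each node: the speaking player i (chosen as a function of the board
   contents so far, i.e. of the position in the tree) writes one bit g (x_i)
   computed from its own input (and the board, again via the position). *)
Inductive protocol (k n : nat) : Type :=
  | CLeaf : bool -> protocol k n
  | CSpeak : 'I_k -> (bits n -> bool) -> protocol k n -> protocol k n -> protocol k n.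

Fixpoint prot_eval k n (p : protocol k n) (x : 'I_k -> bits n) : bool :=
  match p with
  | CLeaf b => b
  | CSpeak i g p0 p1 => if g (x i) then prot_eval p1 x else prot_eval p0 x
  end.

Fixpoint prot_cost k n (p : protocol k n) : nat :=
  match p with
  | CLeaf _ => 0
  | CSpeak _ _ p0 p1 => (maxn (prot_cost p0) (prot_cost p1)).+1
  end.

Definition CC k n (F : ('I_k -> bits n) -> bool) : nat :=
  natmin (fun d => exists p : protocol k n,
             (forall x, prot_eval p x = F x) /\ prot_cost p = d).

Definition xor4 n (x : 'I_4 -> bits n) : bits n :=
  [ffun j => x (inord 0) j (+) x (inord 1) j (+) x (inord 2) j (+) x (inord 3) j].

Definition XOR4 n (f : bits n -> bool) : ('I_4 -> bits n) -> bool :=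
  fun x => f (xor4 x).

(* Main.v *)
(* Following Yao and Sanders.  A protocol of cost k for f(x1 + x2 + x3 + x4)
   yields a monochromatic rectangle A1 x A2 x A3 x A4 with every Ai of density at
   least 2^-k.  Some translates of the Ai meet in a set A of density at least
   2^-4k, and f is constant on a translate of A + A + A + A.  By Sanders'
   quasi-polynomial Bogolyubov-Ruzsa theorem (Croot-Sisask almost periodicity
   followed by Chang's lemma), A + A + A + A contains a subspace W of codimension
   O(k^4), so f is constant on a coset of W.  On that coset the Fourier
   coefficients of f over each nontrivial class modulo the annihilator of W cancel,
   so each class meeting the spectrum meets it at least twice: after querying the
   O(k^4) parities that define W, the number of nonzero frequencies has halved,
   whatever the answers.  This number is at most 2^k initially, by comparison with
   the rank of the matrix (f(x + y)), so k + 1 rounds suffice.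

   Almost periodicity is measured by the proportion of bad points rather than in
   an L^p norm, so that a Chernoff bound replaces the moment inequality. *)
From Stdlib Require Import Reals ClassicalEpsilon.
Require Import Defs.
From mathcomp Require Import all_boot all_order all_algebra.
From mathcomp Require Import Rstruct.
From mathcomp Require Import ring lra zify.
Set Implicit Arguments.
Unset Strict Implicit.
Unset Printing Implicit Defensive.
Import Order.TTheory GRing.Theory Num.Theory.
Local Open Scope ring_scope.

(* Otherwise terms of type [R] are parsed in Stdlib's [R_scope]. *)
Bind Scope ring_scope with R.
Arguments exp x%_ring_scope.

(** * Fourier analysis on the Boolean cube and Chang's lemma *)

Lemma exp_ge1D (x : R) : 1 + x <= exp x.
Proof. by apply/RleP; exact: exp_ineq1_le. Qed.

Lemma expD (x y : R) : exp (x + y) = exp x * exp y.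
Proof. exact: exp_plus. Qed.

Lemma exp_gt0 (x : R) : 0 < exp x.
Proof. by apply/RltP; exact: exp_pos. Qed.

Lemma exp0 : exp 0 = 1.
Proof. exact: exp_0. Qed.

Lemma expN (x : R) : exp (- x) * exp x = 1.
Proof. by rewrite -expD addNr exp0. Qed.

Lemma exp_sum (I : Type) (s : seq I) (F : I -> R) :
  exp (\sum_(i <- s) F i) = \prod_(i <- s) exp (F i).
Proof. exact: (big_morph exp expD exp0). Qed.

Lemma exp_mulrn (x : R) m : exp (x *+ m) = exp x ^+ m.
Proof. by elim: m => [|m IH]; rewrite ?mulr0n ?exp0 // mulrS expD IH exprS. Qed.

Lemma le_exp (x y : R) : x <= y -> exp x <= exp y.
Proof.
move=> le_xy; have -> : y = x + (y - x) by ring.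
rewrite expD; apply: ler_peMr; first exact/ltW/exp_gt0.
by apply: le_trans (exp_ge1D _); lra.
Qed.

(** For [z >= 0] it follows from [(1 + z) * (1 - z + z ^+ 2) = 1 + z ^+ 3]. It bounds products of
    factors near 1 from below, both for Riesz products and for the Chernoff bound. *)
Lemma exp_le1D (z : R) : `|z| <= 4^-1 -> exp (z - z ^+ 2) <= 1 + z.
Proof.
rewrite ler_norml => /andP[z_ge z_le].
suff h : 1 <= (1 + z) * exp (- (z - z ^+ 2)).
  rewrite -(ler_pM2r (exp_gt0 (- (z - z ^+ 2)))) [X in X <= _]mulrC expN.
  exact: h.
have [z_ge0|z_lt0] := lerP 0 z.
  apply: (@le_trans _ _ ((1 + z) * (1 - (z - z ^+ 2)))).
    have -> : (1 + z) * (1 - (z - z ^+ 2)) = 1 + z ^+ 3 by ring.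
    by rewrite lerDl exprn_ge0.
  by apply: ler_wpM2l (exp_ge1D _); lra.
set w := - z; have -> : z = - w by rewrite opprK.
have w0 : 0 < w by rewrite oppr_gt0.
have w4 : w <= 4^-1 by rewrite /w; lra.
(* Applied to [u = w + w ^+ 2] itself, [1 + u <= exp u] would leave [1 - w ^+ 3], which is too
   small; it is applied to [u / 2] and squared. *)
have -> : - (- w - (- w) ^+ 2) = (w + w ^+ 2) / 2 + (w + w ^+ 2) / 2 by field.
rewrite expD.
set e := exp _.
have he : 1 + (w + w ^+ 2) / 2 <= e by exact: exp_ge1D.
have h0 : 0 <= 1 + (w + w ^+ 2) / 2 by nra.
have he2 : (1 + (w + w ^+ 2) / 2) ^+ 2 <= e * e.
  by rewrite -expr2 ler_pXn2r // nnegrE (le_trans h0).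
apply: (@le_trans _ _ ((1 - w) * (1 + (w + w ^+ 2) / 2) ^+ 2)); last first.
  by apply: ler_wpM2l => //; lra.
rewrite -subr_ge0.
have -> : (1 - w) * (1 + (w + w ^+ 2) / 2) ^+ 2 - 1
   = w ^+ 2 * ((1 - w) * (1 + w) ^+ 2 / 4 - w) by field.
by apply: mulr_ge0; [exact: sqr_ge0|nra].
Qed.

(** The graph of [exp] lies above its tangent at [m]. *)
Lemma exp_jensen (I : finType) (T : {set I}) (F : I -> R) (m : R) :
  m *+ #|T| <= \sum_(i in T) F i -> exp m *+ #|T| <= \sum_(i in T) exp (F i).
Proof.
move=> hm; apply: (@le_trans _ _ (\sum_(i in T) exp m * (1 + (F i - m)))).
  rewrite -mulr_sumr !big_split /= sumr_const sumrN sumr_const -[X in X <= _]mulr_natr.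
  by apply: ler_wpM2l; [exact/ltW/exp_gt0|lra].
apply: ler_sum => i _; have -> : F i = m + (F i - m) by ring.
rewrite expD; have -> : m + (F i - m) - m = F i - m by ring.
by apply: ler_wpM2l; [exact/ltW/exp_gt0|exact: exp_ge1D].
Qed.

(** * Characters and the Fourier transform *)

Section Fourier.
Variable n : nat.
Local Notation V := (bits n).
Local Notation N := (#|{: V}|%:R : R).

Lemma cardV_gt0 : 0 < N.
Proof. by rewrite ltr0n; apply/card_gt0P; exists 0. Qed.

Lemma cardV_neq0 : N != 0.
Proof. by rewrite gt_eqF ?cardV_gt0. Qed.

Lemma addvv (x : V) : x + x = 0.
Proof. by apply/ffunP => i; rewrite !ffunE; exact: addbb. Qed.

Lemma addvK (x y : V) : x + y + y = x.
Proof. by rewrite -addrA addvv addr0. Qed.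

Lemma addv_eq0 (x y : V) : (x + y == 0) = (x == y).
Proof. by rewrite -[LHS](inj_eq (addIr y)) addvK add0r. Qed.

Lemma addvI (y : V) : injective (fun x => x + y).
Proof. exact: addIr. Qed.

Lemma reindexv (y : V) (F : V -> R) : \sum_(x : V) F (x + y) = \sum_x F x.
Proof.
rewrite [RHS](reindex_inj (@addvI y)); exact: eq_bigr.
Qed.

Definition dot (a x : V) : bool := \sum_i a i * x i.

Lemma dotC a x : dot a x = dot x a.
Proof. by apply: eq_bigr => i _; rewrite mulrC. Qed.

Lemma dotDr a x y : dot a (x + y) = dot a x (+) dot a y.
Proof.
rewrite -[RHS]/(dot a x + dot a y) -big_split /=.
by apply: eq_bigr => i _; rewrite ffunE mulrDr.
Qed.

Lemma dotDl a b x : dot (a + b) x = dot a x (+) dot b x.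
Proof. by rewrite dotC dotDr !(dotC x). Qed.

Lemma dot0r a : dot a 0 = false.
Proof. by have := dotDr a 0 0; rewrite addr0; case: (dot a 0). Qed.

Lemma dot0l x : dot 0 x = false.
Proof. by rewrite dotC dot0r. Qed.

Lemma dot_neq0 (a : V) : a != 0 -> exists b, dot a b.
Proof.
move=> a0; have [i ai] : exists i, a i.
  apply/existsP; apply: contraNT a0 => /existsPn h.
  by apply/eqP/ffunP => i; rewrite !ffunE; apply/negbTE/h.
exists [ffun j => j == i]; rewrite /dot (bigD1 i) //= big1 => [|j /negbTE ji].
  by rewrite ffunE eqxx ai.
by rewrite ffunE ji mulr0.
Qed.

Definition chi (a x : V) : R := (-1) ^+ dot a x.

Lemma chiC a x : chi a x = chi x a.
Proof. by rewrite /chi dotC. Qed.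

Lemma chiDr a x y : chi a (x + y) = chi a x * chi a y.
Proof. by rewrite /chi dotDr signr_addb. Qed.

Lemma chiDl a b x : chi (a + b) x = chi a x * chi b x.
Proof. by rewrite /chi dotDl signr_addb. Qed.

Lemma chi0r a : chi a 0 = 1.
Proof. by rewrite /chi dot0r. Qed.

Lemma chi0l x : chi 0 x = 1.
Proof. by rewrite /chi dot0l. Qed.

Lemma norm_chi a x : `|chi a x| = 1.
Proof. by rewrite /chi normr_sign. Qed.

Lemma sum_chi a : \sum_x chi a x = if a == 0 then N else 0.
Proof.
have [->|/dot_neq0[b ab]] := eqVneq a 0.
  by rewrite (eq_bigr (fun=> 1)) ?sumr_const // => x _; rewrite chi0l.
have := reindexv b (chi a).
rewrite (eq_bigr (fun x => - chi a x)) => [|x _].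
  by rewrite sumrN; lra.
by rewrite chiDr {2}/chi ab expr1 mulrN1.
Qed.

(** An unnormalised sum, so inversion and Parseval carry the factor [N]. *)
Definition fhat (F : V -> R) (a : V) : R := \sum_x F x * chi a x.

Lemma fourier_inversion F x : N * F x = \sum_a fhat F a * chi a x.
Proof.
rewrite (eq_bigr (fun a => \sum_(y : V) F y * chi (x + y) a)); last first.
  move=> a _; rewrite mulr_suml; apply: eq_bigr => y _.
  by rewrite -mulrA -chiDr addrC chiC.
rewrite exchange_big (bigD1 x) //=.
rewrite -mulr_sumr sum_chi addvv eqxx big1 => [|y yx]; first by rewrite addr0 mulrC.
by rewrite -mulr_sumr sum_chi addv_eq0 eq_sym (negbTE yx) mulr0.
Qed.

Lemma parseval F : \sum_a fhat F a ^+ 2 = N * \sum_x F x ^+ 2.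
Proof.
rewrite mulr_sumr (eq_bigr (fun a => \sum_x F x * (fhat F a * chi a x))); last first.
  by move=> a _; rewrite expr2 {1}/fhat mulr_suml; apply: eq_bigr => x _; ring.
rewrite exchange_big; apply: eq_bigr => x _.
by rewrite -mulr_sumr -fourier_inversion; ring.
Qed.

Definition conv (F G : V -> R) (x : V) : R := \sum_(y : V) F y * G (x + y).

Lemma fhat_conv F G a : fhat (conv F G) a = fhat F a * fhat G a.
Proof.
rewrite /fhat mulr_suml.
rewrite (eq_bigr (fun x => \sum_(y : V) F y * G (x + y) * chi a x)) => [|x _]; last first.
  by rewrite mulr_suml.
rewrite exchange_big; apply: eq_bigr => y _.
rewrite -(reindexv y (fun x => G x * chi a x)) mulr_sumr; apply: eq_bigr => x _.
by rewrite -mulrA -[in LHS](addvK x y) chiDr addvK; ring.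
Qed.

Lemma le_norm_fhat F a : `|fhat F a| <= \sum_x `|F x|.
Proof.
apply: le_trans (ler_norm_sum _ _ _) _.
by apply: ler_sum => x _; rewrite normrM norm_chi mulr1.
Qed.

(** * Triangular systems and Riesz products *)

Definition perp (s : seq (V * V)) (x : V) := all (fun p => ~~ dot p.1 x) s.

(* A triangular system [(g_d, b_d), ..., (g_1, b_1)]: [b_j] is dual to [g_j]
   and orthogonal to every earlier [g_i].  It replaces a basis of the span of
   the [g_i] together with a partial dual basis. *)
Fixpoint triangular (s : seq (V * V)) : bool :=
  if s is p :: s' then [&& dot p.1 p.2, perp s' p.2 & triangular s'] else true.

Lemma perpD s x y : perp s x -> perp s y -> perp s (x + y).
Proof.
move=> /allP hx /allP hy; apply/allP => p ps.
by rewrite dotDr (negbTE (hx p ps)) (negbTE (hy p ps)).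
Qed.

(* Translation by [b_d] flips the sign of the last character and fixes the
   earlier ones, so the last factor averages to [c]. *)
Lemma riesz_sum (c : R) (w : V -> R) s : triangular s ->
  \sum_x \prod_(p <- s) (c + w p.1 * chi p.1 x) = N * c ^+ size s.
Proof.
elim: s => [|[g b] s IH] /=.
  by under eq_bigr do rewrite big_nil; rewrite sumr_const expr0 mulr1.
move=> /and3P[gb sb ts]; set P := fun x => \prod_(p <- s) (c + w p.1 * chi p.1 x).
have hP x : P (x + b) = P x.
  apply: eq_big_seq => p ps; rewrite chiDr.
  by rewrite [chi _ b]/chi (negbTE (allP sb p ps)) mulr1.
have h0 : \sum_x chi g x * P x = 0.
  have := reindexv b (fun x => chi g x * P x).
  rewrite (eq_bigr (fun x => - (chi g x * P x))) => [|x _].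
    by rewrite sumrN; lra.
  by rewrite hP chiDr [chi g b]/chi gb expr1 mulrN1 mulNr.
rewrite (eq_bigr (fun x => c * P x + w g * (chi g x * P x))) => [|x _].
  by rewrite big_split /= -!mulr_sumr h0 mulr0 addr0 IH // exprS; ring.
by rewrite big_cons /= /P; ring.
Qed.

Definition ind (A : {set V}) (x : V) : R := (x \in A)%:R.

Lemma sum_ind (A : {set V}) F : \sum_x ind A x * F x = \sum_(x in A) F x.
Proof.
rewrite [RHS]big_mkcond; apply: eq_bigr => x _.
by rewrite /ind; case: (x \in A); rewrite ?mul1r ?mul0r.
Qed.

(* The Riesz product [Z] averages to 1 over the cube, hence to at most [N / #|T|]
   over [T], while [1 + z >= exp (z - z ^+ 2)] and Jensen bound that average below. *)
Lemma chang (T : {set V}) s : triangular s ->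
    (forall p, p \in s -> #|T|%:R / 2 <= `|fhat (ind T) p.1|) ->
  exp (16^-1 *+ size s) * #|T|%:R <= N.
Proof.
(* The sign aligns each character with its coefficient, and [1 / 4] is the range of [exp_le1D].
   Averaged over [T], each character gains at least [1 / 8] and loses [1 / 16]. *)
move=> ts hs; pose w a : R := Num.sg (fhat (ind T) a) / 4.
pose Z x : R := \prod_(p <- s) (1 + w p.1 * chi p.1 x).
have hw a x : `|w a * chi a x| <= 4^-1.
  rewrite normrM norm_chi mulr1 normrM normr_sg.
  by case: (_ != 0); rewrite /= ?mul0r ?mul1r ?normr0 ?[`|_|]ger0_norm ?invr_ge0.
have hZ x : exp (\sum_(p <- s) (w p.1 * chi p.1 x - 16^-1)) <= Z x.
  rewrite exp_sum; apply: ler_prod => p _; rewrite ltW ?exp_gt0 //=.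
  apply: le_trans (exp_le1D (hw p.1 x)); apply: le_exp.
  rewrite lerD2l lerN2; have := hw p.1 x.
  rewrite -real_normK ?num_real // => h; have := normr_ge0 (w p.1 * chi p.1 x).
  nra.
have Z0 x : 0 <= Z x by apply: le_trans (hZ x); exact/ltW/exp_gt0.
have sZ : \sum_x Z x = N by rewrite riesz_sum // expr1n mulr1.
rewrite -sZ (bigID (mem T)) /= -[X in X <= _]addr0 lerD ?sumr_ge0 //.
apply: le_trans (ler_sum _ (fun x _ => hZ x)).
rewrite mulr_natr; apply: exp_jensen.
have -> : 16^-1 *+ size s *+ #|T| = \sum_(p <- s) (16^-1 *+ #|T| : R).
  by rewrite big_const_seq count_predT iter_addr_0 -!mulrnA mulnC.
rewrite exchange_big /= big_seq [X in _ <= X]big_seq; apply: ler_sum => p ps.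
rewrite sumrB sumr_const -mulr_sumr -sum_ind -/(fhat _ _).
have -> : w p.1 * fhat (ind T) p.1 = `|fhat (ind T) p.1| / 4.
  by rewrite normrEsg /w; ring.
have := hs _ ps; rewrite -[16^-1 *+ _]mulr_natr; lra.
Qed.

End Fourier.

(** * Croot-Sisask almost periodicity *)

Lemma sum_natr_card (T : finType) (P Q : pred T) :
  \sum_(x | P x) (Q x)%:R = #|[set x | P x && Q x]|%:R :> R.
Proof.
rewrite -sum1_card natr_sum [LHS]big_mkcond [RHS]big_mkcond.
by apply: eq_bigr => x _; rewrite inE; case: (P x); case: (Q x).
Qed.

(* The products [\prod_i (1 + d / 2 * y (c i))] average to 1 over [A ^ L]. *)
Lemma chernoff (T : finType) (A : {set T}) (y : T -> R) L (d : R) :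
    0 <= d <= 2^-1 -> (forall a, a \in A -> `|y a| <= 1) -> \sum_(a in A) y a = 0 ->
  #|[set c : {ffun 'I_L -> T} | (c \in ffun_on A) && (d *+ L < \sum_i y (c i))]|%:R
    * exp ((d ^+ 2 / 4) *+ L) <= #|A|%:R ^+ L.
Proof.
move=> /andP[d0 d2] y1 sy.
pose Z (c : {ffun 'I_L -> T}) : R := \prod_i (1 + d / 2 * y (c i)).
have sZ : \sum_(c in ffun_on A) Z c = #|A|%:R ^+ L.
  rewrite -(bigA_distr_big (fun a => a \in A) (fun _ a => 1 + d / 2 * y a)).
  rewrite prodr_const card_ord; congr (_ ^+ _).
  by rewrite big_split /= sumr_const -mulr_sumr sy mulr0 addr0.
have hZ c : c \in ffun_on A ->
    exp (d / 2 * (\sum_i y (c i)) - (d ^+ 2 / 4) *+ L) <= Z c.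
  move=> /ffun_onP cA.
  have -> : d / 2 * (\sum_i y (c i)) - (d ^+ 2 / 4) *+ L =
      \sum_i (d / 2 * y (c i) - d ^+ 2 / 4).
    by rewrite sumrB mulr_sumr sumr_const card_ord.
  rewrite exp_sum; apply: ler_prod => i _; rewrite ltW ?exp_gt0 //=.
  have := y1 _ (cA i); set v := y (c i) => hv.
  have hv2 : v ^+ 2 <= 1 by rewrite -real_normK ?num_real // expr_le1.
  apply: le_trans (exp_le1D _).
    by apply: le_exp; rewrite lerD2l lerN2 exprMn; have := sqr_ge0 d; nra.
  rewrite normrM ger0_norm; last by lra.
  by have := normr_ge0 v; nra.
rewrite -sZ (bigID (fun c : {ffun _ -> _} => d *+ L < \sum_i y (c i))) /=.
rewrite -[X in X <= _]addr0 lerD //; last first.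
  by apply: sumr_ge0 => c /andP[cA _]; apply: le_trans (hZ c cA); exact/ltW/exp_gt0.
rewrite mulr_natl -sumr_const.
rewrite [X in X <= _](eq_bigl (fun c : {ffun 'I_L -> T} =>
    (c \in ffun_on A) && (d *+ L < \sum_i y (c i)))); last by move=> c; rewrite inE.
(* On the tail the linear term is at least [d / 2 * (d *+ L)], twice the quadratic loss. *)
apply: ler_sum => c /andP[cA hc]; apply: le_trans (hZ c cA); apply: le_exp.
rewrite lerBrDr; apply: (@le_trans _ _ (d / 2 * (d *+ L))).
  rewrite mulrnAr -mulrnDl; have -> // : d / 2 * d = d ^+ 2 / 4 + d ^+ 2 / 4.
  by field.
by apply: ler_wpM2l (ltW hc); lra.
Qed.

Lemma chernoff_abs (T : finType) (A : {set T}) (y : T -> R) L (d : R) :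
    0 <= d <= 2^-1 -> (forall a, a \in A -> `|y a| <= 1) -> \sum_(a in A) y a = 0 ->
  #|[set c : {ffun 'I_L -> T} | (c \in ffun_on A) && (d *+ L < `|\sum_i y (c i)|)]|%:R
    * exp ((d ^+ 2 / 4) *+ L) <= 2 * #|A|%:R ^+ L.
Proof.
move=> hd y1 sy; have h1 := chernoff L hd y1 sy.
have h2 := @chernoff T A (fun a => - y a) L d hd.
have {}h2 := h2 (fun a aA => etrans (congr1 (<=%R^~ 1) (normrN _)) (y1 a aA)).
rewrite sumrN sy oppr0 in h2; have {}h2 := h2 erefl.
rewrite [2 * _]mulr_natl mulr2n; apply: le_trans (lerD h1 h2).
rewrite -mulrDl; apply: ler_wpM2r; first exact/ltW/exp_gt0.
rewrite -natrD ler_nat; apply: leq_trans (leq_card_setU _ _).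
apply: subset_leq_card; apply/subsetP => c; rewrite !inE => /andP[-> /=].
by rewrite ltr_normr sumrN.
Qed.

Section CrootSisask.
Variable n : nat.
Local Notation V := (bits n).
Local Notation N := (#|{: V}|%:R : R).

Variables (A : {set V}) (h : V -> R).
Hypothesis A_gt0 : (0 < #|A|)%N.
Hypothesis h01 : forall x, 0 <= h x <= 1.

(** In characteristic 2 this is the convolution of [h] with the uniform measure on [A]. *)
Definition avg (x : V) : R := (\sum_(a in A) h (x + a)) / #|A|%:R.

Let A0 : 0 < #|A|%:R :> R.
Proof. by rewrite ltr0n. Qed.

Lemma avg01 x : 0 <= avg x <= 1.
Proof.
rewrite /avg ler_pdivlMr // ler_pdivrMr // mul0r mul1r; apply/andP; split.
  by apply: sumr_ge0 => a _; case/andP: (h01 (x + a)).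
rewrite -sumr_const; apply: ler_sum => a _.
by case/andP: (h01 (x + a)).
Qed.

Variables (L : nat) (d e : R).
Hypothesis L_gt0 : (0 < L)%N.
Hypothesis d01 : 0 <= d <= 2^-1.
Hypothesis e_gt0 : 0 < e.
Hypothesis exp_large : 4 <= e * exp ((d ^+ 2 / 4) *+ L).

(** A tuple [c] samples [avg] by the mean of the [h (x + c i)]; it is good if the sampling error
    exceeds [d] on at most a proportion [e] of the points. *)
Let dev (c : {ffun 'I_L -> V}) x : R := `|\sum_i (h (x + c i) - avg x)|.
Let bad c := [set x | d *+ L < dev c x].
Let good : {set {ffun 'I_L -> V}} :=
  [set c in ffun_on A | #|bad c|%:R <= e * N].

(** At each fixed [x] the Chernoff bound applies, and [exp_large] makes the failure probability at
    most [e / 2]. *)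
Lemma sum_bad : \sum_(c in ffun_on A) #|bad c|%:R <= N * #|A|%:R ^+ L * e / 2.
Proof.
rewrite (eq_bigr (fun c => \sum_x (x \in bad c)%:R)); last first.
  move=> c _; rewrite (sum_natr_card predT); congr (_%:R).
  by apply: eq_card => z; rewrite !inE.
rewrite exchange_big /=.
have -> : N * #|A|%:R ^+ L * e / 2 = \sum_(x : V) (#|A|%:R ^+ L * e / 2).
  by rewrite sumr_const -[RHS]mulr_natl !mulrA.
apply: ler_sum => x _.
have y1 a : a \in A -> `|h (x + a) - avg x| <= 1.
  move=> _; have := h01 (x + a); have := avg01 x.
  move=> /andP[? ?] /andP[? ?]; rewrite ler_norml; lra.
have sy : \sum_(a in A) (h (x + a) - avg x) = 0.
  by rewrite sumrB sumr_const -mulr_natr /avg divfK ?subrr ?gt_eqF.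
have := chernoff_abs L d01 y1 sy; set E := exp _ => hc.
have E0 : 0 < E by exact: exp_gt0.
have -> : \sum_(c in ffun_on A) (x \in bad c)%:R = #|[set c : {ffun 'I_L -> V} |
   (c \in ffun_on A) && (d *+ L < `|\sum_i (h (x + c i) - avg x)|)]|%:R :> R.
  by rewrite sum_natr_card; congr (_%:R); apply: eq_card => c; rewrite !inE.
rewrite -(ler_pM2r E0); apply: le_trans hc _.
have P0 : 0 <= #|A|%:R ^+ L :> R by rewrite exprn_ge0 ?ler0n.
have := ler_wpM2l P0 exp_large; rewrite -/E; lra.
Qed.

(** Markov's inequality: the mean size of [bad c] is at most half the threshold [e * N]. *)
Lemma card_good : #|A|%:R ^+ L <= 2 * #|good|%:R :> R.
Proof.
have N0 := cardV_gt0 n.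
have cA : #|A|%:R ^+ L = \sum_(c : {ffun 'I_L -> V} | c \in ffun_on A) 1 :> R.
  by rewrite sumr_const card_ffun_on card_ord natrX.
have : \sum_(c in ffun_on A) (e * N) * (1 - (c \in good)%:R) <=
       \sum_(c in ffun_on A) #|bad c|%:R.
  apply: ler_sum => c cA'; rewrite inE cA' /=.
  have [_|/ltW] := lerP #|bad c|%:R (e * N); first by rewrite subrr mulr0.
  by rewrite subr0 mulr1.
rewrite -mulr_sumr sumrB -cA => hb; have {}hb := le_trans hb sum_bad; move: hb.
have -> : \sum_(c in ffun_on A) (c \in good)%:R = #|good|%:R :> R.
  rewrite sum_natr_card; congr (_%:R); apply: eq_card => c.
  by rewrite !inE andbA andbb.
move=> hb; rewrite -(ler_pM2l (mulr_gt0 e_gt0 N0)).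
move: hb N0; set x := #|A|%:R ^+ L; set g := #|good|%:R; set m := N.
by move=> hb N0; lra.
Qed.

(* Tuples in [good] sample [avg] well.  Some coset of the diagonal of [V ^ L] meets
   [good] in at least the average proportion; two good tuples [c + t0] and
   [c + t0 + t] on it give translates of the same sampled function. *)
Lemma croot_sisask : exists T : {set V},
  [/\ T != set0, N * #|A|%:R ^+ L <= 2 * #|T|%:R * N ^+ L &
   forall t, t \in T ->
     #|[set x : V | 2 * d < `|avg (x + t) - avg x|]|%:R <= 2 * e * N].
Proof.
have N0 := cardV_gt0 n.
pose shift (c : {ffun 'I_L -> V}) t : {ffun 'I_L -> V} := [ffun i => c i + t].
pose X c := [set t | shift c t \in good].
have [c hc] : exists c, N * #|A|%:R ^+ L <= 2 * #|X c|%:R * N ^+ L.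
  apply/existsP; rewrite -[X in is_true X]negbK; apply/negP => /existsPn hX.
  have sX : \sum_c #|X c|%:R = N * #|good|%:R.
    rewrite (eq_bigr (fun c => \sum_(t : V) (shift c t \in good)%:R)); last first.
      by move=> c _; rewrite (sum_natr_card predT).
    rewrite exchange_big /= mulr_natl -sumr_const; apply: eq_bigr => t _.
    have shK : involutive (shift^~ t).
      by move=> c; apply/ffunP => i; rewrite !ffunE addvK.
    rewrite (reindex_inj (inv_inj shK)) /=.
    rewrite (eq_bigr (fun c => (c \in good)%:R)) => [|c _]; last by rewrite shK.
    rewrite (sum_natr_card predT); congr (_%:R).
    by apply: eq_card => z; rewrite !inE.
  have : \sum_c 2 * #|X c|%:R * N ^+ L < \sum_(c : {ffun 'I_L -> V}) N * #|A|%:R ^+ L.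
    apply: ltr_sum => [|c _]; last by rewrite ltNge; exact: hX.
    by apply/hasP; exists [ffun=> 0]; rewrite // mem_index_enum.
  have cF : #|{: {ffun 'I_L -> V}}| = (#|{: V}| ^ L)%N by rewrite card_ffun card_ord.
  rewrite -mulr_suml -mulr_sumr sX sumr_const [X in _ < _ *+ X]cF -[X in _ < X]mulr_natl natrX.
  have := card_good; have NL : 0 < N ^+ L by rewrite exprn_gt0.
  set x := #|A|%:R ^+ L; set y := #|good|%:R; set z := N ^+ L => h1 h2.
  have h3 := ler_wpM2l (ltW (mulr_gt0 N0 NL)) h1; move: h2 h3; rewrite -/z => h2 h3; lra.
have [t0 t0X] : exists t0, t0 \in X c.
  apply/set0Pn; apply: contraTneq hc => ->; rewrite cards0 mulr0 mul0r -ltNge.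
  by rewrite mulr_gt0 ?exprn_gt0.
exists [set t : V | t + t0 \in X c]; split.
- by apply/set0Pn; exists 0; rewrite inE add0r.
- suff -> : #|[set t : V | t + t0 \in X c]| = #|X c| by [].
  rewrite -(card_imset (X c) (@addvI n t0)); apply: eq_card => t.
  apply/idP/imsetP => [tX|[x xX ->]]; last by rewrite inE addvK.
  by exists (t + t0); rewrite ?addvK //; rewrite inE in tX.
move=> t; rewrite !inE => /andP[_ hs].
have {t0X} hs0 : #|bad (shift c t0)|%:R <= e * N.
  by move: t0X; rewrite !inE => /andP[].
pose B2 := [set x + t | x : V in bad (shift c t0)].
have cB2 : #|B2| = #|bad (shift c t0)| by rewrite card_imset //; exact: addvI.
(* Since [x + t + (c i + t0) = x + (c i + (t + t0))], off both bad sets [avg x] and [avg (x + t)]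
   are within [d] of the same sample mean. *)
have sub : [set x : V | 2 * d < `|avg (x + t) - avg x|] \subset bad (shift c (t + t0)) :|: B2.
  apply/subsetP => x; rewrite !inE; apply: contraTT.
  rewrite negb_or -!leNgt => /andP[h1].
  have : x \notin B2 -> x + t \notin bad (shift c t0).
    by apply: contra => xt; apply/imsetP; exists (x + t); rewrite ?addvK.
  move=> /[apply]; rewrite inE -leNgt => h2.
  rewrite -(ler_pM2r (_ : 0 < L%:R)) ?ltr0n //.
  have -> : `|avg (x + t) - avg x| * L%:R =
     `|\sum_i (h (x + shift c (t + t0) i) - avg x)
       - \sum_i (h (x + t + shift c t0 i) - avg (x + t))|.
    rewrite -sumrB (eq_bigr (fun=> avg (x + t) - avg x)) => [|i _]; last first.
      have -> : x + t + shift c t0 i = x + shift c (t + t0) i.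
        by rewrite /shift !ffunE -!addrA [t + (_ + _)]addrCA.
      by ring.
    by rewrite sumr_const card_ord normrMn mulr_natr.
  apply: le_trans (ler_normB _ _) _.
  move: h1 h2; rewrite /dev -[d *+ L]mulr_natr => h1 h2; lra.
apply: (@le_trans _ _ (#|bad (shift c (t + t0))| + #|B2|)%:R).
  by rewrite ler_nat; apply: leq_trans (leq_card_setU _ _); exact: subset_leq_card.
by rewrite natrD cB2; lra.
Qed.

End CrootSisask.

(** * The Bogolyubov-Ruzsa theorem for A + A + A + A *)

Lemma exp_natr_ge m : 2 ^+ m <= exp m%:R.
Proof.
rewrite exp_mulrn; apply: lerXn2r; rewrite ?nnegrE //; first exact/ltW/exp_gt0.
by have := exp_ge1D 1; lra.
Qed.

Section Bogolyubov.
Variable n : nat.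
Local Notation V := (bits n).
Local Notation N := (#|{: V}|%:R : R).

(** Greedy choice: while some [a] in [S] is nonzero at some [v] in [perp s], the pair [(a, v)]
    extends [s]; the bound [B] forces termination. *)
Lemma exists_triangular_span (S : pred V) B :
    (forall s, triangular s -> all (fun p => S p.1) s -> (size s < B)%N) ->
  exists s : seq (V * V), [/\ triangular s, all (fun p => S p.1) s &
    forall a v, S a -> perp s v -> ~~ dot a v].
Proof.
move=> hB.
suff H m : forall s : seq (V * V), triangular s -> all (fun p => S p.1) s ->
    (B <= size s + m)%N -> exists s : seq (V * V), [/\ triangular s, all (fun p => S p.1) s &
    forall a v, S a -> perp s v -> ~~ dot a v].
  exact: (H B [::]).
elim: m => [|m IH] s ts sS hs.
  by have := hB s ts sS; rewrite addn0 in hs; rewrite ltnNge hs.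
have [/existsP[[a v] /and3P[/= Sa sv av]]|/existsPn h] :=
    boolP [exists p : V * V, [&& S p.1, perp s p.2 & dot p.1 p.2]].
  apply: (IH ((a, v) :: s)) => /=; first by rewrite av sv ts.
    by rewrite Sa sS.
  by rewrite addSnnS.
exists s; split=> // a v Sa sv; apply/negP => av.
by have := h (a, v); rewrite /= Sa sv av.
Qed.

Lemma avg_close (A : {set V}) F x b c : (0 < #|A|)%N ->
    (forall a, a \in A -> `|F (x + a) - b| <= c) -> `|avg A F x - b| <= c.
Proof.
move=> A0 h; have A0' : 0 < #|A|%:R :> R by rewrite ltr0n.
have -> : avg A F x - b = (\sum_(a in A) (F (x + a) - b)) / #|A|%:R.
  by rewrite sumrB sumr_const -[b *+ _]mulr_natr mulrBl mulfK ?gt_eqF.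
rewrite normrM [`|_^-1|]ger0_norm ?invr_ge0 ?ler0n // ler_pdivrMr //.
rewrite mulr_natr -sumr_const; apply: le_trans (ler_norm_sum _ _ _) _; exact: ler_sum.
Qed.

Lemma fhat_avg (A : {set V}) F a :
  fhat (avg A F) a = fhat (ind A) a / #|A|%:R * fhat F a.
Proof.
have -> : fhat (ind A) a / #|A|%:R * fhat F a = fhat (conv (ind A) F) a / #|A|%:R.
  by rewrite fhat_conv; ring.
rewrite /fhat mulr_suml; apply: eq_bigr => x _.
by rewrite /avg /conv sum_ind; ring.
Qed.

Lemma fhat_iter_avg (T : {set V}) F l a :
  fhat (iter l (avg T) F) a = (fhat (ind T) a / #|T|%:R) ^+ l * fhat F a.
Proof.
by elim: l => [|l IH] /=; rewrite ?expr0 ?mul1r // fhat_avg IH exprS mulrA.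
Qed.

Lemma norm_fhat_ind (A : {set V}) a : `|fhat (ind A) a| <= #|A|%:R.
Proof.
apply: le_trans (le_norm_fhat _ _) _.
rewrite (eq_bigr (fun x => ind A x * 1)) => [|x _].
  by rewrite sum_ind sumr_const.
by rewrite /ind; case: (_ \in _); rewrite ?normr1 ?normr0 mulr1.
Qed.

Lemma sum_sqr_fhat_ind (A : {set V}) : \sum_a fhat (ind A) a ^+ 2 = N * #|A|%:R.
Proof.
rewrite parseval; congr (_ * _); rewrite -[RHS]sumr_const -sum_ind; apply: eq_bigr => x _.
by rewrite /ind; case: (_ \in _); rewrite ?expr1n ?expr0n ?mulr1.
Qed.

Variables (A : {set V}) (K : nat).
Hypothesis A_large : (#|{: V}| <= 2 ^ K * #|A|)%N.

Let A_gt0 : (0 < #|A|)%N.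
Proof.
case: posnP A_large => // ->; rewrite muln0 leqn0 => /eqP h.
by have := cardV_gt0 n; rewrite h ltxx.
Qed.

Let A0 : 0 < #|A|%:R :> R.
Proof. by rewrite ltr0n. Qed.

Let A_large_R : N <= 2 ^+ K * #|A|%:R.
Proof. by rewrite -natrX -natrM ler_nat. Qed.

(** [g v] is the probability that [v + a + b] lies in [A + A] for random [a], [b] in [A]. So
    [g 0 = 1], and [g] vanishes outside [A + A + A + A]. *)
Let h : V -> R := ind [set a + b | a : V in A, b : V in A].
Let f := avg A h.
Let g := avg A f.

Let h01 x : 0 <= h x <= 1.
Proof. by rewrite /h /ind; case: (_ \in _); rewrite ?lexx ler01. Qed.

Lemma avg_avg_sumset0 : g 0 = 1.
Proof.
have f1 a : a \in A -> f a = 1.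
  move=> aA; rewrite /f /avg (eq_bigr (fun=> 1)) => [|b bA].
    by rewrite sumr_const divff // gt_eqF.
  by rewrite /h /ind; case: imset2P => // -[]; exists a b.
rewrite /g /avg (eq_bigr (fun=> 1)) => [|b bA].
  by rewrite sumr_const divff // gt_eqF.
by rewrite add0r f1.
Qed.

Lemma avg_avg_sumset_gt0 v : 0 < g v -> exists a b c d,
  [/\ [/\ a \in A, b \in A, c \in A & d \in A] & v = a + b + c + d].
Proof.
have pos (F : V -> R) x : (forall x, 0 <= F x) -> 0 < avg A F x ->
    exists2 a, a \in A & 0 < F (x + a).
  move=> F0; rewrite /avg pmulr_lgt0 ?invr_gt0 // => hs.
  apply/exists_inP; apply: contraTT hs => /exists_inPn hs; rewrite -leNgt.
  by apply: sumr_le0 => a aA; rewrite leNgt hs.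
have f0 x : 0 <= f x by case/andP: (avg01 A_gt0 h01 x).
move=> /(pos _ _ f0)[a aA] /pos[x|b bA]; first by case/andP: (h01 x).
rewrite /h /ind; case: imset2P => [[c d cA dA e] _|]; last by rewrite ltxx.
exists c, d, b, a; split=> //.
by rewrite -e !addvK.
Qed.

(* [L] is chosen so that [d ^+ 2 / 4 *+ L = 2 * K + 13]. *)
Let l := (K + 5)%N.
Let L := ((80 * l) ^ 2 * (2 * K + 13))%N.
Let d : R := (40 * l%:R)^-1.
Let e : R := d / 2 ^+ K.

Let l0 : 0 < l%:R :> R.
Proof. by rewrite ltr0n /l addnS. Qed.

(** In [2 * K + 13 = K + (8 + l)], the [K] cancels the denominator of [e], [2 ^ l] exceeds [l], and
    [2 ^ 8] covers [4 * 40]. *)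
Let exp_large : 4 <= e * exp ((d ^+ 2 / 4) *+ L).
Proof.
have -> : (d ^+ 2 / 4) *+ L = (2 * K + 13)%:R.
  rewrite -[_ *+ L]mulr_natr /L natrM natrX natrM mulrA -[RHS]mul1r; congr (_ * _).
  by rewrite /d; field; rewrite gt_eqF.
apply: (@le_trans _ _ (e * 2 ^+ (2 * K + 13))); last first.
  apply: ler_wpM2l (exp_natr_ge _); rewrite /e /d.
  by rewrite divr_ge0 ?invr_ge0 ?mulr_ge0 ?exprn_ge0 ?ltW.
have -> : (2 * K + 13 = K + (8 + l))%N by rewrite /l; lia.
rewrite exprD /e mulrA divfK ?expf_neq0 ?pnatr_eq0 // /d mulrC.
rewrite ler_pdivlMr ?mulr_gt0 // exprD.
have hl : (l <= 2 ^ l)%N by exact/ltnW/ltn_expl.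
have {hl} : l%:R <= 2 ^+ l :> R by rewrite -natrX ler_nat.
move: l0; set p := 2 ^+ l; set q := l%:R => q0 hl.
have -> : 2 ^+ 8 = 256 :> R by ring.
by lra.
Qed.

(* [g] moves by at most [4 d = 1 / (10 l)] under each translation in [T], hence
   by at most [1/10] under [l] successive averagings over [T].  After these, all
   Fourier coefficients outside the large spectrum of [T] have been damped by
   [2^-l], so the average is nearly constant on the annihilator of that
   spectrum, whose codimension is controlled by Chang's lemma. *)
Lemma bogolyubov_span : exists s : seq (V * V),
  [/\ triangular s, (size s < 16 * (K * L + 2))%N & forall v, perp s v -> 0 < g v].
Proof.
have N0 := cardV_gt0 n.
have L_gt0 : (0 < L)%N.
  by rewrite /L muln_gt0 expn_gt0 muln_gt0 /l addnS /= addn_gt0 orbT.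
have d0 : 0 < d by rewrite /d invr_gt0 mulr_gt0.
have d01 : 0 <= d <= 2^-1.
  rewrite ltW //= /d lef_pV2 ?posrE ?mulr_gt0 //.
  have : 1 <= l%:R :> R by rewrite (ler_nat _ 1) /l addnS.
  by move=> h1; lra.
have e0 : 0 < e by rewrite /e divr_gt0 ?exprn_gt0.
have [T [T_neq0 T_large hT]] := croot_sisask A_gt0 h01 L_gt0 d01 e0 exp_large.
have T_gt0 : (0 < #|T|)%N by rewrite card_gt0.
have T0 : 0 < #|T|%:R :> R by rewrite ltr0n.
have NT : N <= 2 ^+ (K * L + 1) * #|T|%:R.
  have AL0 : 0 < #|A|%:R ^+ L :> R by rewrite exprn_gt0.
  rewrite -(ler_pM2r AL0); apply: le_trans T_large _.
  have -> : 2 ^+ (K * L + 1) * #|T|%:R * #|A|%:R ^+ L =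
      2 * #|T|%:R * (2 ^+ K * #|A|%:R) ^+ L :> R.
    by rewrite exprD exprM exprMn; ring.
  apply: ler_wpM2l; first by rewrite mulr_ge0 ?ler0n.
  by apply: lerXn2r; rewrite // nnegrE ?mulr_ge0 ?exprn_ge0 ?ler0n.
pose S a := #|T|%:R / 2 <= `|fhat (ind T) a|.
(* A longer system would give [2 ^+ (K * L + 2) * #|T| <= N] by Chang's lemma, against [NT]. *)
have hB s : triangular s -> all (fun p => S p.1) s -> (size s < 16 * (K * L + 2))%N.
  move=> ts sS; rewrite ltnNge; apply/negP => hs.
  have hc := chang ts (fun p ps => allP sS p ps).
  have h1 : 2 ^+ (K * L + 2) <= exp (16^-1 *+ size s).
    apply: le_trans (exp_natr_ge _) _; apply: le_exp.
    rewrite -[_ *+ size s]mulr_natl ler_pdivlMr // -natrM ler_nat mulnC //.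
  have := le_trans (ler_wpM2r (ltW T0) h1) (le_trans hc NT).
  rewrite ler_pM2r // ler_eXn2l ?ltr1n //.
  by rewrite leq_add2l.
have [s [ts sS span]] := exists_triangular_span hB.
exists s; split=> [//||v sv]; first exact: hB.
have gT t x : t \in T -> `|g (x + t) - g x| <= 4 * d.
  move=> tT; set B := [set x : V | 2 * d < `|f (x + t) - f x|].
  (* By the choice [e = d / 2 ^+ K], the points where [f] moves by more than [2 * d] add at most
     [2 * d] to an average over [A], as [f] moves by at most 1 there. *)
  have hBT : #|B|%:R <= 2 * d * #|A|%:R.
    apply: le_trans (hT t tT) _; rewrite -!mulrA; apply: ler_wpM2l => //.
    by apply: ler_wpM2l; [exact: ltW | rewrite ler_pdivrMl ?exprn_gt0].
  have -> : g (x + t) - g x = (\sum_(a in A) (f (x + a + t) - f (x + a))) / #|A|%:R.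
    rewrite sumrB mulrBl; congr (_ / _ - _).
    by apply: eq_bigr => a _; rewrite addrAC.
  rewrite normrM [`|_^-1|]ger0_norm ?invr_ge0 ?ler0n // ler_pdivrMr //.
  apply: le_trans (ler_norm_sum _ _ _) _.
  apply: (@le_trans _ _ (\sum_(a in A) (2 * d + (x + a \in B)%:R))).
    apply: ler_sum => a aA; rewrite inE.
    have [hle|_] := lerP `|f (x + a + t) - f (x + a)| (2 * d); first by rewrite addr0.
    case/andP: (avg01 A_gt0 h01 (x + a)) => f1 f2.
    case/andP: (avg01 A_gt0 h01 (x + a + t)) => f3 f4.
    rewrite -/f in f1 f2 f3 f4; rewrite ler_norml mulr1n; lra.
  rewrite big_split /= sumr_const sum_natr_card.
  have : #|[set a : V | (a \in A) && (x + a \in B)]|%:R <= #|B|%:R :> R.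
    rewrite ler_nat -(card_imset _ (@addvI n x)); apply: subset_leq_card.
    apply/subsetP => y /imsetP[a]; rewrite inE => /andP[_ xaB] ->.
    by rewrite addrC.
  by rewrite -[_ *+ #|A|]mulr_natr; lra.
pose G m := iter m (avg T) g.
have hG m x : `|G m x - g x| <= 4 * d *+ m.
  elim: m x => [|m IH] x; first by rewrite subrr normr0.
  apply: avg_close => // t tT.
  have -> : G m (x + t) - g x = (G m (x + t) - g (x + t)) + (g (x + t) - g x) by ring.
  by apply: le_trans (ler_normD _ _) _; rewrite mulrSr lerD ?IH ?gT.
have hGl x : `|G l x - g x| <= 10^-1.
  apply: le_trans (hG l x) _; rewrite -[_ *+ l]mulr_natr /d.
  suff -> : 4 * (40 * l%:R)^-1 * l%:R = 10^-1 :> R by [].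
  by field; rewrite gt_eqF.
(* The two averagings over [A] supply the square of [fhat (ind A) a], which makes the sum over [a]
   computable by Parseval. *)
have fhG a : `|fhat (G l) a * (chi a v - 1)| <=
    2 * 2^-1 ^+ l * N * (fhat (ind A) a ^+ 2 / #|A|%:R ^+ 2).
  have [aS|aS] := boolP (S a).
    rewrite /chi (negbTE (span a v aS sv)) expr0 subrr mulr0 normr0.
    apply: mulr_ge0; last by rewrite divr_ge0 ?sqr_ge0.
    apply: mulr_ge0; last exact: ltW.
    apply: mulr_ge0; first by [].
    by rewrite exprn_ge0 // invr_ge0.
  have tau : `|fhat (ind T) a / #|T|%:R| <= 2^-1.
    rewrite normrM [`|_^-1|]ger0_norm ?invr_ge0 ?ler0n // ler_pdivrMr //.
    by rewrite -ltNge in aS; rewrite mulrC ltW.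
  have hh : `|fhat h a| <= N.
    by apply: le_trans (norm_fhat_ind _ _) _; rewrite ler_nat max_card.
  have chi2 : `|chi a v - 1| <= 2.
    by apply: le_trans (ler_normB _ _) _; rewrite norm_chi normr1.
  have -> : 2 * 2^-1 ^+ l * N * (fhat (ind A) a ^+ 2 / #|A|%:R ^+ 2) =
      2^-1 ^+ l * (`|fhat (ind A) a / #|A|%:R| ^+ 2 * N) * 2.
    by rewrite real_normK ?num_real // expr_div_n; ring.
  rewrite /G fhat_iter_avg /g /f !fhat_avg normrM [`|_ ^+ l * _|]normrM normrX.
  apply: ler_pM; rewrite ?mulr_ge0 ?exprn_ge0 //.
  apply: ler_pM; rewrite ?exprn_ge0 //; first by apply: lerXn2r; rewrite ?nnegrE ?invr_ge0 ?ler0n.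
  set w := fhat (ind A) a / _; rewrite !normrM mulrA expr2; apply: ler_wpM2l => //.
  by rewrite !mulr_ge0.
have hGv : `|G l v - G l 0| <= 16^-1.
  rewrite -(ler_pM2l N0) -{1}[N]ger0_norm ?(ltW N0) // -normrM mulrBr !fourier_inversion.
  have -> : \sum_a fhat (G l) a * chi a v - \sum_a fhat (G l) a * chi a 0 =
      \sum_a fhat (G l) a * (chi a v - 1).
    by rewrite -sumrB; apply: eq_bigr => a _; rewrite chi0r mulrBr.
  apply: le_trans (ler_norm_sum _ _ _) _.
  apply: le_trans (ler_sum _ (fun a _ => fhG a)) _.
  rewrite -mulr_sumr -mulr_suml sum_sqr_fhat_ind.
  (* Here [l = K + 5] is used: [2 * 2 ^ (- l) = 16^-1 * 2 ^ (- K)], and the density of [A] absorbs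
     [2 ^ K]. *)
  have -> : 2 * 2^-1 ^+ l * N * (N * #|A|%:R / #|A|%:R ^+ 2) =
     N * (16^-1 * (N / (2 ^+ K * #|A|%:R))) :> R.
    rewrite /l exprD exprVn.
    have h1 : #|A|%:R != 0 :> R by rewrite gt_eqF.
    have h2 : 2 ^+ K != 0 :> R by rewrite expf_neq0 ?pnatr_eq0.
    by move: h1 h2; set p := 2 ^+ K; set q := #|A|%:R; set r := N => h1 h2; field; rewrite h1 h2.
  apply: ler_wpM2l; first exact: ltW.
  by rewrite ler_piMr ?invr_ge0 // ler_pdivrMr ?mulr_gt0 ?exprn_gt0 // mul1r.
(* Altogether [g v >= 1 - 1/10 - 1/16 - 1/10 > 0]. *)
have := hGl v; have := hGl 0; have := hGv; rewrite avg_avg_sumset0 !ler_norml.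
by move=> /andP[h1 h2] /andP[h3 h4] /andP[h5 h6]; lra.
Qed.

End Bogolyubov.

(** The codimension is of order [K * L] with [L] of order [K ^ 3]; the constant comes from
    [K + 5 <= 6 * K] and [2 * K + 13 <= 15 * K]. *)
Lemma bogolyubov : exists C0 : nat, forall n (A : {set bits n}) K,
    (0 < K)%N -> (#|{: bits n}| <= 2 ^ K * #|A|)%N ->
  exists s : seq (bits n * bits n), [/\ triangular s, (size s <= C0 * K ^ 4)%N &
    forall v, perp s v -> exists a b c d,
      [/\ [/\ a \in A, b \in A, c \in A & d \in A] & v = a + b + c + d]].
Proof.
exists (16 * ((80 * 6) ^ 2 * 15 + 2))%N => n A K K0 hA.
have [s [ts ss hs]] := bogolyubov_span hA.
exists s; split=> // [|v /hs gv]; last exact: (avg_avg_sumset_gt0 hA gv).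
apply: leq_trans (ltnW ss) _.
have hl : ((80 * (K + 5)) ^ 2 <= (80 * 6) ^ 2 * K ^ 2)%N.
  by rewrite -expnMn leq_exp2r // -mulnA leq_mul2l /=; lia.
have hM : (2 * K + 13 <= 15 * K)%N by lia.
have hK : (1 <= K ^ 4)%N by rewrite expn_gt0 K0.
have := leq_mul (leqnn K) (leq_mul hl hM).
move: ((80 * 6) ^ 2)%N ((80 * (K + 5)) ^ 2 * _)%N => c m hm.
have -> : (16 * (c * 15 + 2) * K ^ 4 = 16 * (K * (c * K ^ 2 * (15 * K)) + 2 * K ^ 4))%N by ring.
by rewrite leq_mul2l /= leq_add // leq_pmulr.
Qed.

(** * Protocols and rectangles *)

(** A witness rules out the default value 0, by well-ordering. *)
Lemma natmin_spec (P : nat -> Prop) m : P m -> P (natmin P) /\ (natmin P <= m)%N.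
Proof.
move=> Pm; rewrite /natmin; case: excluded_middle_informative => [h|[]].
  by case: constructive_indefinite_description => /= d [Pd dmin]; split=> //; exact: dmin.
elim/ltn_ind: m Pm => m IH Pm.
have [[e [Pe em]]|h] := excluded_middle_informative (exists e, P e /\ (e < m)%N).
  exact: IH em Pe.
exists m; split=> // e Pe; rewrite leqNgt; apply/negP => em.
by apply: h; exists e.
Qed.

Section Protocols.
Variable n : nat.
Local Notation V := (bits n).

Lemma xor4E (x : 'I_4 -> V) : xor4 x = \sum_i x i.
Proof.
have -> : \sum_i x i = x (inord 0) + x (inord 1) + x (inord 2) + x (inord 3).
  rewrite !big_ord_recr big_ord0 /= add0r; congr (x _ + x _ + x _ + x _);
  by apply: val_inj; rewrite /= inordK.
by apply/ffunP => j; rewrite !ffunE.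
Qed.

Definition computes (p : protocol 4 n) (f : V -> bool) :=
  forall x, prot_eval p x = f (\sum_i x i).

Lemma sum_delta (x : V) :
  \sum_j (if x j then [ffun i => i == j] else 0) = x.
Proof.
apply/ffunP => i; rewrite sum_ffunE (bigD1 i) //= big1 => [|j /negbTE ji].
  by rewrite addr0; case: (x i); rewrite ffunE ?eqxx.
by case: (x j); rewrite ffunE // eq_sym ji.
Qed.

(** Ensures that [CC] is attained: the players announce all their bits, and each announced 1 shifts
    the function still to be computed. *)
Lemma exists_protocol (f : V -> bool) : exists p, computes p f.
Proof.
have H (s : seq ('I_4 * 'I_n)) : forall f : V -> bool, exists p : protocol 4 n, forall x,
    prot_eval p x = f (\sum_(q <- s) (if x q.1 q.2 then [ffun i => i == q.2] else 0)).
  elim: s => [|[i j] s IH] F; first by exists (CLeaf 4 n (F 0)) => x; rewrite big_nil.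
  have [p0 h0] := IH F; have [p1 h1] := IH (fun y => F ([ffun i => i == j] + y)).
  exists (CSpeak i (fun v => v j) p0 p1) => x; rewrite big_cons /= h0 h1.
  by case: (x i j); rewrite ?add0r.
have [p hp] := H [seq (i, j) | i <- index_enum 'I_4, j <- index_enum 'I_n] f.
exists p => x; rewrite hp big_allpairs; congr f; apply: eq_bigr => i _.
by rewrite -[RHS]sum_delta; exact: eq_bigr.
Qed.

(** Each player transforms its own input, at no cost; this carries a protocol over to restrictions
    of [f]. *)
Fixpoint precomp (phi : 'I_4 -> V -> V) (p : protocol 4 n) : protocol 4 n :=
  match p with
  | CLeaf b => CLeaf 4 n b
  | CSpeak i g p0 p1 => CSpeak i (fun v => g (phi i v)) (precomp phi p0) (precomp phi p1)
  end.

Lemma precomp_eval phi p x : prot_eval (precomp phi p) x = prot_eval p (fun i => phi i (x i)).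
Proof. by elim: p => //= i g p0 -> p1 ->. Qed.

Lemma precomp_cost phi p : prot_cost (precomp phi p) = prot_cost p.
Proof. by elim: p => //= i g p0 -> p1 ->. Qed.

(** Following at each node the bit more frequent on the speaker's current set halves that set at
    worst and leaves the others alone. *)
Lemma monochromatic_rectangle (p : protocol 4 n) (B : 'I_4 -> {set V}) :
  exists (A : 'I_4 -> {set V}) b, (forall i, (#|B i| <= 2 ^ prot_cost p * #|A i|)%N) /\
    (forall i, A i \subset B i) /\ (forall x, (forall i, x i \in A i) -> prot_eval p x = b).
Proof.
elim: p B => [b|i g p0 IH0 p1 IH1] B /=.
  by exists B, b; split=> // i; rewrite expn0 mul1n.
have [c hc] : exists c, (#|B i| <= 2 * #|[set v in B i | g v == c]|)%N.
  have hB : (#|B i| = #|[set v in B i | g v == true]| + #|[set v in B i | g v == false]|)%N.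
    rewrite -(cardsID [set v | g v] (B i)); congr (_ + _)%N; apply: eq_card => v.
      by rewrite !inE eqb_id.
    by rewrite !inE eqbF_neg andbC.
  have [h|h] := leqP #|[set v in B i | g v == true]| #|[set v in B i | g v == false]|.
    by exists false; rewrite hB; lia.
  by exists true; rewrite hB; lia.
pose B' j := if j == i then [set v in B i | g v == c] else B j.
have [A [b [h1 [h2 h3]]]] : exists (A : 'I_4 -> {set V}) b,
    (forall j, (#|B' j| <= 2 ^ maxn (prot_cost p0) (prot_cost p1) * #|A j|)%N) /\
    (forall j, A j \subset B' j) /\
    (forall x, (forall j, x j \in A j) -> prot_eval (if c then p1 else p0) x = b).
  case: c @B' {hc} => B'.
    have [A [b [h1 h2]]] := IH1 B'; exists A, b; split=> // j.
    by apply: leq_trans (h1 j) _; rewrite leq_mul2r leq_exp2l // leq_maxr orbT.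
  have [A [b [h1 h2]]] := IH0 B'; exists A, b; split=> // j.
  by apply: leq_trans (h1 j) _; rewrite leq_mul2r leq_exp2l // leq_maxl orbT.
exists A, b; split=> [j|]; last split=> [j|x hx].
- have := h1 j; rewrite /B' expnS -mulnA; case: eqP => [->|_] h; last first.
    exact: leq_trans h (leq_pmull _ _).
  by apply: leq_trans hc _; rewrite leq_mul2l.
- apply: subset_trans (h2 j) _; rewrite /B'; case: eqP => [->|//].
  by apply/subsetP => v; rewrite inE => /andP[].
- have := subsetP (h2 i) _ (hx i); rewrite /B' eqxx inE => /andP[_ /eqP ->].
  by rewrite -(h3 x hx); case: (c).
Qed.

(** Averaged over [s], the intersection has [#|A| * #|B| / N] elements. *)
Lemma dense_inter_translate (A B : {set V}) a b :
    (#|{: V}| <= 2 ^ a * #|A|)%N -> (#|{: V}| <= 2 ^ b * #|B|)%N ->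
  exists s : V, (#|{: V}| <= 2 ^ (a + b) * #|A :&: [set x : V | (x + s)%R \in B]|)%N.
Proof.
move=> hA hB.
have sum : (\sum_(s : V) #|A :&: [set x : V | (x + s)%R \in B]| = #|A| * #|B|)%N.
  rewrite (eq_bigr (fun s => \sum_(x in A) ((x + s)%R \in B))%N) => [|s _]; last first.
    rewrite -sum1_card [LHS]big_mkcond [RHS]big_mkcond; apply: eq_bigr => x _.
    by rewrite !inE; case: (x \in A) => //=; case: (_ \in B).
  rewrite exchange_big -sum_nat_const; apply: eq_bigr => x _.
  rewrite -sum1_card [RHS]big_mkcond [RHS](reindex_inj (addrI x)).
  by apply: eq_bigr => s _; case: (_ \in B).
apply/existsP; rewrite -[X in is_true X]negbK; apply/negP => /existsPn h.
have N0 : (0 < #|{: V}|)%N by apply/card_gt0P; exists 0.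
have lt : (\sum_(s : V) 2 ^ (a + b) * #|A :&: [set x : V | (x + s)%R \in B]| <
    #|{: V}| * #|{: V}|)%N.
  apply: (@leq_ltn_trans (#|{: V}| * #|{: V}|.-1)); last by rewrite ltn_pmul2l // prednK.
  rewrite -sum_nat_const; apply: leq_sum => s _.
  by rewrite -ltnS prednK // ltnNge h.
rewrite -big_distrr /= sum expnD in lt.
have := leq_mul hA hB; set x := (2 ^ a)%N in lt *; set y := (2 ^ b)%N in lt *.
by rewrite leqNgt mulnACA lt.
Qed.

(** With player [i0] holding [x] and the others holding functions of [y], each leaf contributes one
    product function, and there are at most [2 ^ prot_cost p] leaves. *)
Lemma rank_one_decomposition (p : protocol 4 n) (i0 : 'I_4) (z : V -> 'I_4 -> V) :
  exists s : seq ((V -> R) * (V -> R)), (size s <= 2 ^ prot_cost p)%N /\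
    forall x y, (prot_eval p (fun i => if i == i0 then x else z y i))%:R =
      \sum_(q <- s) q.1 x * q.2 y :> R.
Proof.
elim: p => [b|i g p0 [s0 [c0 h0]] p1 [s1 [c1 h1]]].
  exists [:: (fun=> b%:R, fun=> 1)]; split=> // x y.
  by rewrite big_seq1 mulr1.
pose r (c : bool) (q : (V -> R) * (V -> R)) : (V -> R) * (V -> R) :=
  if i == i0 then (fun x => (g x == c)%:R * q.1 x, q.2)
  else (q.1, fun y => (g (z y i) == c)%:R * q.2 y).
exists (map (r false) s0 ++ map (r true) s1); split.
  rewrite size_cat !size_map /= expnS mul2n -addnn.
  apply: leq_add; [apply: leq_trans c0 _|apply: leq_trans c1 _];
  by rewrite leq_exp2l // ?leq_maxl ?leq_maxr.
move=> x y; have hr c q : (r c q).1 x * (r c q).2 y =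
    (g (if i == i0 then x else z y i) == c)%:R * (q.1 x * q.2 y).
  by rewrite /r; case: (i == i0) => /=; ring.
rewrite big_cat !big_map /= !(eq_bigr _ (fun q _ => hr _ q)) -!mulr_sumr -h0 -h1.
by case: (g _); rewrite /= ?mul1r ?mul0r ?add0r ?addr0.
Qed.

End Protocols.

(** * Restriction to cosets and the Fourier spectrum *)

Section Spectrum.
Variable n : nat.
Local Notation V := (bits n).
Local Notation N := (#|{: V}|%:R : R).

Definition sel (b : bool) (v : V) : V := if b then v else 0.

Lemma sel_addb b c v : sel (b (+) c) v = sel b v + sel c v.
Proof. by case: b c => -[]; rewrite /= ?addvv ?addr0 ?add0r. Qed.

Lemma dot_sel a b v : dot a (sel b v) = b && dot a v.
Proof. by case: b; rewrite //= dot0r. Qed.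

(* The projection onto [perp s] along the span of the second components. *)
Fixpoint proj (s : seq (V * V)) (x : V) : V :=
  if s is p :: s' then proj s' x + sel (dot p.1 (proj s' x)) p.2 else x.

(** The transpose of [proj s]. For triangular [s], its nonempty fibres are the cosets of the span of
    the first components. *)
Fixpoint proj_adj (s : seq (V * V)) (a : V) : V :=
  if s is p :: s' then proj_adj s' (a + sel (dot a p.2) p.1) else a.

Lemma projD s x y : proj s (x + y) = proj s x + proj s y.
Proof.
by elim: s => //= p s ->; rewrite dotDr sel_addb addrACA.
Qed.

Lemma proj0 s : proj s 0 = 0.
Proof. by have := projD s 0 0; rewrite addr0 -{1}[proj s 0]addr0 => /addrI. Qed.

Lemma proj_sum s (I : finType) (F : I -> V) : proj s (\sum_i F i) = \sum_i proj s (F i).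
Proof. exact: (big_morph _ (projD s) (proj0 s)). Qed.

Lemma dot_proj s a x : dot a (proj s x) = dot (proj_adj s a) x.
Proof.
elim: s a => //= p s IH a.
rewrite -IH dotDr dotDl dot_sel [dot (sel _ _) _]dotC dot_sel andbC.
by rewrite [dot p.1 _]dotC.
Qed.

Lemma chi_proj s a x : chi a (proj s x) = chi (proj_adj s a) x.
Proof. by rewrite /chi dot_proj. Qed.

Lemma proj_adj0 s : proj_adj s 0 = 0.
Proof. by elim: s => //= p s IH; rewrite dot0l addr0. Qed.

Lemma perp_proj s x : triangular s -> perp s (proj s x).
Proof.
elim: s => //= p s IH /and3P[pp sp ts]; apply/andP; split.
  by rewrite dotDr dot_sel pp andbT addbb.
apply: perpD; first exact: IH.
by rewrite /sel; case: ifP => // _; apply/allP => q _; rewrite dot0r.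
Qed.

Lemma proj_id s x : perp s x -> proj s x = x.
Proof.
by elim: s => //= p s IH /andP[px sx]; rewrite IH // (negbTE px) addr0.
Qed.

Definition real_of (f : V -> bool) (x : V) : R := (f x)%:R.

(** The frequency 0 is left out, so that constants have empty spectrum. *)
Definition spectrum (f : V -> bool) : {set V} :=
  [set a : V | (a != 0) && (fhat (real_of f) a != 0)].

(** By inversion and orthogonality: restriction to a coset merges the frequencies of a fibre, each
    twisted by a sign depending on the coset. *)
Lemma fhat_proj s (c : V) F b :
  fhat (fun x => F (c + proj s x)) b =
  \sum_(a | proj_adj s a == b) fhat F a * chi a c.
Proof.
apply: (mulfI (cardV_neq0 n)); rewrite /fhat mulr_sumr.
rewrite (eq_bigr (fun x => \sum_a fhat F a * chi a c * chi (proj_adj s a + b) x)).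
  rewrite exchange_big mulr_sumr [RHS]big_mkcond; apply: eq_bigr => a _.
  by rewrite -mulr_sumr sum_chi addv_eq0; case: eqP; rewrite ?mulr0 // mulrC.
move=> x _; rewrite mulrA fourier_inversion mulr_suml; apply: eq_bigr => a _.
by rewrite chiDr chi_proj chiDl !mulrA.
Qed.

Lemma fhat_const (F : V -> R) r b : (forall x, F x = r) -> b != 0 -> fhat F b = 0.
Proof.
move=> Fr /negbTE b0; rewrite /fhat (eq_bigr (fun x => r * chi b x)) => [|x _].
  by rewrite -mulr_sumr sum_chi b0 mulr0.
by rewrite Fr.
Qed.

Lemma spectrum0_const f : spectrum f = set0 -> forall x, f x = f 0.
Proof.
move=> f0 x; have N0 := cardV_neq0 n.
have e y : N * real_of f y = fhat (real_of f) 0.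
  rewrite fourier_inversion (bigD1 (0 : V)) //= chi0l mulr1 big1 ?addr0 // => a a0.
  have : a \notin spectrum f by rewrite f0 inE.
  by rewrite inE a0 /= negbK => /eqP ->; rewrite mul0r.
have /(mulfI N0) := etrans (e x) (esym (e 0)).
by rewrite /real_of => /eqP; rewrite eqr_nat; case: (f x); case: (f 0).
Qed.

(* If [f] is constant on one coset of [perp s], the Fourier coefficients of [f]
   over every nonzero fibre of [proj_adj s] cancel there, so no such fibre meets
   the spectrum in a single point. *)
Lemma spectrum_halving s (f : V -> bool) (v0 : V) b (v : V) : triangular s ->
    (forall w, perp s w -> f (v0 + w) = b) ->
  (2 * #|spectrum (fun x => f (v + proj s x)%R)| <= #|spectrum f|)%N.
Proof.
move=> ts fb; set g := fun x => _.
have fib c : c \in spectrum g ->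
    (2 <= #|[set a in spectrum f | proj_adj s a == c]|)%N.
  rewrite inE => /andP[c0 gc].
  have nz : fhat (real_of g) c = \sum_(a | proj_adj s a == c) fhat (real_of f) a * chi a v.
    exact: (fhat_proj s v (real_of f)).
  have z : \sum_(a | proj_adj s a == c) fhat (real_of f) a * chi a v0 = 0.
    rewrite -(fhat_proj s v0 (real_of f)); apply: (@fhat_const _ b%:R) => // x.
    by rewrite /real_of fb // perp_proj.
  have inS a : proj_adj s a == c -> fhat (real_of f) a != 0 ->
      a \in [set a in spectrum f | proj_adj s a == c].
    move=> ac fa; rewrite !inE ac fa !andbT; apply: contraNneq c0 => a0.
    by rewrite -(eqP ac) a0 proj_adj0.
  have [a1 /andP[a1c fa1]] : exists a, (proj_adj s a == c) && (fhat (real_of f) a != 0).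
    apply/existsP; apply: contraNT gc => /existsPn h; rewrite nz big1 // => a ac.
    by have := h a; rewrite ac /= negbK => /eqP ->; rewrite mul0r.
  have [a2 /and3P[a2c fa2 a21]] : exists a, [&& proj_adj s a == c,
      fhat (real_of f) a != 0 & a != a1].
    apply/existsP; apply: contraNT fa1 => /existsPn h.
    move: z; rewrite (bigD1 a1) //= big1 ?addr0 => [|a /andP[ac aa1]].
      by move=> /eqP; rewrite mulf_eq0 -[chi a1 v0 == 0]normr_eq0 norm_chi oner_eq0 orbF.
    by have := h a; rewrite ac aa1 andbT /= negbK => /eqP ->; rewrite mul0r.
  have <- : #|[set a1; a2]| = 2%N by rewrite cards2 eq_sym a21.
  apply: subset_leq_card; apply/subsetP => a.
  by rewrite in_set2 => /orP[] /eqP ->; exact: inS.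
rewrite mulnC -sum_nat_const.
apply: (@leq_trans (\sum_(c in spectrum g) #|[set a in spectrum f | proj_adj s a == c]|)).
  exact: leq_sum.
rewrite (eq_bigr (fun c => \sum_(a in spectrum f) (proj_adj s a == c))%N) => [|c _]; last first.
  rewrite -sum1_card [LHS]big_mkcond [RHS]big_mkcond; apply: eq_bigr => a _.
  by rewrite inE; case: (a \in _) => //=; case: (_ == _).
rewrite exchange_big -sum1_card; apply: leq_sum => a _ /=.
have [h|h] := boolP (proj_adj s a \in spectrum g).
  by rewrite (bigD1 _ h) /= eqxx big1 // => c /andP[_]; rewrite eq_sym => /negbTE ->.
by rewrite big1 // => c hc; case: eqP => // e; rewrite e hc in h.
Qed.

(** Characters diagonalise the matrix [(f (x + y))]; its block on the spectrum is invertible and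
    factors through dimension [size s]. *)
Lemma card_spectrum_le f (s : seq ((V -> R) * (V -> R))) :
    (forall x y, real_of f (x + y) = \sum_(q <- s) q.1 x * q.2 y) ->
  (#|spectrum f| <= size s)%N.
Proof.
move=> hs; set S := spectrum f; set m := size s.
pose q0 : (V -> R) * (V -> R) := (fun=> 0, fun=> 0).
pose P : 'M[R]_(#|S|, m) := \matrix_(i, k) fhat (nth q0 s k).1 (enum_val i).
pose Q : 'M[R]_(m, #|S|) := \matrix_(k, j) fhat (nth q0 s k).2 (enum_val j).
have PQ : P *m Q = diag_mx (\row_j (N * fhat (real_of f) (enum_val j))).
  apply/matrixP => i j; rewrite !mxE.
  set a := enum_val i; set b := enum_val j.
  have -> : (\sum_k P i k * Q k j) =
      \sum_(x : V) \sum_(y : V) real_of f (x + y) * (chi a x * chi b y).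
    rewrite (eq_bigr (fun k : 'I_m => \sum_(x : V) \sum_(y : V)
        (nth q0 s k).1 x * (nth q0 s k).2 y * (chi a x * chi b y))).
      rewrite exchange_big; apply: eq_bigr => x _.
      rewrite exchange_big; apply: eq_bigr => y _.
      by rewrite -mulr_suml hs (big_nth q0) big_mkord.
    move=> k _; rewrite !mxE /fhat mulr_suml; apply: eq_bigr => x _.
    by rewrite mulr_sumr; apply: eq_bigr => y _; rewrite -/a -/b; ring.
  rewrite (eq_bigr (fun x => fhat (real_of f) b * chi (a + b) x)) => [|x _].
    rewrite -mulr_sumr sum_chi addv_eq0 /a /b (inj_eq enum_val_inj).
    by case: eqP => [->|_]; rewrite ?mulr1n ?mulr0n ?mulr0 // mulrC.
  rewrite /fhat mulr_suml -(reindexv x (fun y => real_of f y * chi b y * chi (a + b) x)).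
  apply: eq_bigr => y _; rewrite [y + x]addrC chiDr chiDl.
  have chi2 : chi b x * chi b x = 1 by rewrite -chiDr addvv chi0r.
  by rewrite -[LHS]mulr1 -chi2; ring.
have u : P *m Q \in unitmx.
  rewrite unitmxE PQ det_diag unitfE; apply/prodf_neq0 => j _; rewrite mxE.
  rewrite mulf_neq0 ?cardV_neq0 //.
  by have := enum_valP j; rewrite inE => /andP[].
rewrite -(mxrank_unit u); apply: leq_trans (mxrankM_maxl _ _) _.
exact: rank_leq_col.
Qed.

Lemma card_spectrum_cost p f : computes p f -> (#|spectrum f| <= 2 ^ prot_cost p)%N.
Proof.
move=> pf.
have [s [ss hs]] := rank_one_decomposition p ord0 (fun y i => if i == ord_max then y else 0).
apply: leq_trans ss; apply: card_spectrum_le => x y; rewrite -hs pf /real_of.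
congr (f _)%:R; rewrite !big_ord_recr big_ord0 /=.
by rewrite add0r !addr0.
Qed.

End Spectrum.

(** * Decision trees *)

Lemma constant_on_coset : exists C0, forall n (f : bits n -> bool) (p : protocol 4 n) k,
    computes p f -> (prot_cost p <= k)%N -> (0 < k)%N ->
  exists s v0 b, [/\ triangular s, (size s <= C0 * (4 * k) ^ 4)%N &
    forall w, perp s w -> f (v0 + w) = b].
Proof.
have [C0 hC0] := bogolyubov; exists C0 => n f p k pf pk k0.
have [A [b [cA [_ hA]]]] := monochromatic_rectangle p (fun=> setT).
have {}cA i : (#|{: bits n}| <= 2 ^ k * #|A i|)%N.
  rewrite -[X in (X <= _)%N]cardsT; apply: leq_trans (cA i) _.
  by rewrite leq_mul2r leq_exp2l // pk orbT.
have [s1 h1] := dense_inter_translate (cA (inord 0)) (cA (inord 1)).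
have [s2 h2] := dense_inter_translate h1 (cA (inord 2)).
have [s3 h3] := dense_inter_translate h2 (cA (inord 3)).
set I := (_ :&: _ :&: _ :&: _) in h3.
have eK : (k + k + k + k = 4 * k)%N by lia.
rewrite eK in h3; have [|s [ts ss hs]] := hC0 n I (4 * k)%N _ h3; first by rewrite muln_gt0.
exists s, (s1 + s2 + s3), b; split=> // w /hs[x0 [x1 [x2 [x3 [[i0 i1 i2 i3] ->]]]]].
(* The shifts return the points of [I] to the sides of the rectangle; their total is the base point
   of the coset. *)
pose x (i : 'I_4) := nth 0 [:: x0; x1 + s1; x2 + s2; x3 + s3] i.
have <- : \sum_i x i = s1 + s2 + s3 + (x0 + x1 + x2 + x3).
  rewrite !big_ord_recr big_ord0 /x /= add0r.
  by rewrite [RHS]addrC [RHS]addrACA [x0 + x1 + x2 + _]addrACA [x0 + (x1 + s1)]addrA.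
rewrite -pf; apply: hA => i; rewrite -[i]inord_val /x.
case: i => [[|[|[|[|//]]]] lt_i4] /=; rewrite inordK //=.
- by move: i0; rewrite !inE -!andbA => /and4P[].
- by move: i1; rewrite !inE -!andbA => /and4P[].
- by move: i2; rewrite !inE -!andbA => /and4P[].
- by move: i3; rewrite !inE -!andbA => /and4P[].
Qed.

Section DecisionTrees.
Variable n : nat.
Local Notation V := (bits n).

Lemma parityE (a x : V) : parity [set i | a i] x = dot a x.
Proof.
rewrite /parity /dot big_mkcond; apply: eq_bigr => i _.
by rewrite inE; case: (a i); rewrite ?mul1r ?mul0r.
Qed.

(** The first components of [s] are queried in turn, and [P] records the answers so far; in the end
    [P] lies in one coset of [perp s]. *)
Lemma pdt_of_cosets (f : V -> bool) D s (P : pred V) :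
    (forall v, P v -> exists t : pdt n, (pdt_depth t <= D)%N /\
      forall x, P x -> perp s (x + v) -> pdt_eval t x = f x) ->
  exists t : pdt n, (pdt_depth t <= D + size s)%N /\
    forall x, P x -> pdt_eval t x = f x.
Proof.
elim: s P => [|p s IH] P h /=.
  have [/existsP[v Pv]|/existsPn P0] := boolP [exists v, P v].
    have [t [dt ht]] := h v Pv; exists t; rewrite addn0; split=> // x Px.
    exact: ht.
  (* No input gives these answers, so the label is arbitrary. *)
  by exists (PLeaf n true); split=> // x Px; have := P0 x; rewrite Px.
have branch c : exists t : pdt n, (pdt_depth t <= D + size s)%N /\
    forall x, P x && (dot p.1 x == c) -> pdt_eval t x = f x.
  apply: (IH (fun x => P x && (dot p.1 x == c))) => v /andP[Pv /eqP vc].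
  have [t [dt ht]] := h v Pv; exists t; split=> // x /andP[Px /eqP xc] sx.
  by apply: ht => //=; rewrite dotDr xc vc addbb.
have [t0 [d0 h0]] := branch false; have [t1 [d1 h1]] := branch true.
exists (PQuery [set i | p.1 i] t0 t1); split=> [|x Px] /=.
  by rewrite addnS ltnS geq_max d0 d1.
by rewrite parityE; case: ifP => px; [apply: h1|apply: h0]; rewrite Px px.
Qed.

Lemma pdt_of_spectrum D k :
    (forall (f : V -> bool) p, computes p f -> (prot_cost p <= k)%N ->
      exists s v0 b, [/\ triangular s, (size s <= D)%N &
        forall w, perp s w -> f (v0 + w) = b]) ->
  forall j (f : V -> bool) p, computes p f -> (prot_cost p <= k)%N ->
    (#|spectrum f| < 2 ^ j)%N ->
  exists t : pdt n, (pdt_depth t <= j * D)%N /\ forall x, pdt_eval t x = f x.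
Proof.
move=> H; elim=> [|j IH] f p pf pk fj.
  have f0 : spectrum f = set0 by apply/eqP; rewrite -cards_eq0 -leqn0 -ltnS.
  by exists (PLeaf n (f 0)); split=> // x /=; rewrite (spectrum0_const f0 x).
have [s [v0 [b [ts ss hb]]]] := H f p pf pk.
have [|t [dt ht]] := @pdt_of_cosets f (j * D) s predT; last first.
- exists t; split=> [|x]; last exact: ht.
  by apply: leq_trans dt _; rewrite mulSn addnC leq_add2r.
(* With this offset, [c + proj s x = x] for every [x] in the coset of [v]. *)
move=> v _; pose c := v + proj s v.
(* All players project and one adds [c], so the inputs sum to [c + proj s x], where [x] is the
   original sum. *)
pose phi (i : 'I_4) x := (if i == ord0 then c else 0) + proj s x.
have [|||t [dt ht]] := IH (fun x => f (c + proj s x)) (precomp phi p).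
- move=> x; rewrite precomp_eval pf; congr f.
  rewrite big_split /= proj_sum; congr (_ + _).
  by rewrite -big_mkcond big_pred1_eq.
- by rewrite precomp_cost.
- have := spectrum_halving c ts hb => h.
  by rewrite -(ltn_pmul2l (isT : 0 < 2)%N) -expnS; apply: leq_ltn_trans h fj.
exists t; split=> // x _ sx; rewrite ht /c -addrA -projD [v + x]addrC proj_id //.
by rewrite addrC addvK.
Qed.

End DecisionTrees.

(** * The fifth-power bound *)

Lemma PDT_le_CC4 : exists C0 : nat, forall n (f : bits n -> bool),
  (PDT f <= C0 * CC (XOR4 f) ^ 5)%N.
Proof.
have [C0 hC0] := constant_on_coset; exists (2 * C0 * 4 ^ 4)%N => n f.
have PDT_le (t : pdt n) : (forall x, pdt_eval t x = f x) -> (PDT f <= pdt_depth t)%N.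
  by move=> ht; apply: (natmin_spec _).2; exists t.
have [p0 hp0] := exists_protocol f.
have [|[p [pf pk]] _] := @natmin_spec (fun d => exists p : protocol 4 n,
    (forall x, prot_eval p x = XOR4 f x) /\ prot_cost p = d) (prot_cost p0).
  by exists p0; split=> // x; rewrite hp0 /XOR4 xor4E.
rewrite -/(CC (XOR4 f)) in pk.
have {}pf : computes p f by move=> x; rewrite pf /XOR4 xor4E.
set k := CC _ in pk *.
(* For [k = 0] the [k.+1] rounds are too many, but the protocol is a leaf and [f] is constant.
   Otherwise [k.+1 <= 2 * k] gives the factor 2 in the constant. *)
have [k0|k_gt0] := posnP k.
  rewrite k0 exp0n // muln0; apply: (PDT_le (PLeaf n (f 0))) => x /=.
  have fE y : f y = prot_eval p (fun i => if i == ord0 then y else 0).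
    by rewrite pf -big_mkcond big_pred1_eq.
  by rewrite !fE; case: p pk {pf fE}; rewrite k0.
have [|t [dt ht]] := @pdt_of_spectrum n (C0 * (4 * k) ^ 4) k
  (fun F q hF hq => hC0 n F q k hF hq k_gt0) k.+1 f p pf (eq_leq pk).
  by apply: leq_ltn_trans (card_spectrum_cost pf) _; rewrite pk ltn_exp2l.
apply: leq_trans (PDT_le t ht) _; apply: leq_trans dt _.
have hk : (k.+1 <= 2 * k)%N by rewrite mul2n -addnn -addn1 leq_add2l.
apply: leq_trans (leq_mul hk (leqnn _)) _.
by rewrite expnMn (expnS k 4) leq_eqVlt; apply/orP; left; apply/eqP; ring.
Qed.

(* MathComp uses the key [R] for [ring_scope]. *)
Delimit Scope R_scope with R.

Theorem theorem1p4 :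
  exists C : R, (0 < C)%R /\
    forall (n : nat) (f : bits n -> bool), (1 <= n)%N ->
      (INR (PDT f) <= C * INR (CC (XOR4 f)) ^ 5)%R.
Proof.
(* The successor guarantees positivity. *)
have [C0 hC0] := PDT_le_CC4; exists (INR C0.+1); split.
  exact: lt_0_INR (Nat.lt_0_succ _).
move=> n f _; apply/RleP; rewrite RmultE RpowE !INRE -natrX -natrM ler_nat.
by apply: leq_trans (hC0 n f) _; rewrite leq_mul2r leqnSn orbT.
Qed.
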